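(* Let $\Omega\subset\mathbb{R}^d\setminus\{0\}$ be a domain. If $f\in\mathcal{BV}_{\mathcal H_a}(\Omega)$, then $$|\nabla_{\mathcal H_a}f|(\Omega)\le\int_{-\infty}^{+\infty}P_{\mathcal H_a}(E_t,\Omega)\,dt,$$ where $E_t=\{x\in\Omega:f(x)>t\}$ for $t\in\mathbb{R}$.
   Context: Let $d\ge 2$, $a\ge -(\frac d2-1)^2$, $\sigma:=\frac{d-2}{2}-\frac12\sqrt{(d-2)^2+4a}$. For $1\le i\le d$ put $A_{-i,a}=\frac{\partial}{\partial x_i}-\sigma\frac{x_i}{|x|^2}$, and for $\varphi=(\varphi_1,\dots,\varphi_d)\in C_c^1(\Omega,\mathbb{R}^d)$ let $\mathrm{div}_{\mathcal H_a}\varphi=\sum_{i=1}^dA_{-i,a}\varphi_i$. The $\mathcal H_a$-variation of $f\in L^1(\Omega)$ is $|\nabla_{\mathcal H_a}f|(\Omega)=\sup\int_\Omega f\,\mathrm{div}_{\mathcal H_a}\varphi\,dx$ over $\varphi\in C_c^1(\Omega,\mathbb{R}^d)$ with $\sup_{x\in\Omega}|\varphi(x)|\le1$; $\mathcal{BV}_{\mathcal H_a}(\Omega)$ is the set of $f\in L^1(\Omega)$ with $|\nabla_{\mathcal H_a}f|(\Omega)<\infty$. The $\mathcal H_a$-perimeter of a measurable $E\subseteq\Omega$ is $P_{\mathcal H_a}(E,\Omega)=\sup\int_E\mathrm{div}_{\mathcal H_a}\varphi\,dx$ over the same $\varphi$ (possibly $+\infty$). *)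

(* Defs.v *)
From HB Require Import structures.
From mathcomp Require Import all_boot all_order all_algebra.
From mathcomp Require Import all_classical all_reals all_analysis.

Set Implicit Arguments.
Unset Strict Implicit.
Unset Printing Implicit Defensive.

Import Order.TTheory GRing.Theory Num.Theory.
Import numFieldNormedType.Exports.

Local Open Scope classical_set_scope.
Local Open Scope ring_scope.

Section lebesgue_rV.
Context {R : realType} {d : nat}.
Local Notation V := 'rV[R]_d.

(* The library has no Lebesgue measure on R^d: it is built here from the outer
   measure "infimum of the total volumes of the countable covers by boxes".
   [Some (a, b)] codes the box \prod_i ]a_i, b_i]; [None] codes the empty set,
   so that finite covers are allowed whatever d is (the only box of R^0 is not
   empty). *)
Definition box (c : option (V * V)) : set V :=
  if c is Some (a, b) then [set x : V | forall i, a 0 i < x 0 i <= b 0 i]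
  else set0.

Definition box_volume (c : option (V * V)) : R :=
  if c is Some (a, b) then \prod_(i < d) Num.max 0 (b 0 i - a 0 i) else 0.

Local Open Scope ereal_scope.

Definition lebesgue_outer (A : set V) : \bar R :=
  ereal_inf [set \sum_(k <oo) (box_volume (c k))%:E
            | c in [set c : nat -> option (V * V) |
                      A `<=` \bigcup_k box (c k)]].

Lemma box_volume_ge0 c : 0 <= (box_volume c)%:E.
Proof.
rewrite lee_fin; case: c => [[a b]|] //=.
by apply: prodr_ge0 => i _; rewrite le_max lexx.
Qed.

Lemma lebesgue_outer_ge0 A : 0 <= lebesgue_outer A.
Proof.
apply: le_ereal_inf_tmp => _ [c _ <-].
by apply: nneseries_ge0 => k _ _; exact: box_volume_ge0.
Qed.

Lemma lebesgue_outer0 : lebesgue_outer set0 = 0.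
Proof.
apply/eqP; rewrite eq_le lebesgue_outer_ge0 andbT.
apply: ereal_inf_lbound; exists (fun=> None); first by [].
by rewrite eseries0.
Qed.

Lemma le_lebesgue_outer : {homo lebesgue_outer : A B / A `<=` B >-> A <= B}.
Proof.
move=> A B AB; apply: le_ereal_inf_tmp => _ [c Bc <-].
by apply: ereal_inf_lbound; exists c => //; exact: subset_trans Bc.
Qed.

Lemma lebesgue_outer_sigma_subadditive : sigma_subadditive lebesgue_outer.
Proof.
move=> A; have [[i ioo]|] := pselect (exists i, lebesgue_outer (A i) = +oo).
  rewrite (eseries_pinfty _ _ ioo) ?leey// => n _.
  by rewrite -ltNye (lt_le_trans _ (lebesgue_outer_ge0 _)).
rewrite -forallNE => Aoo.
apply/lee_addgt0Pr => _/posnumP[e].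
rewrite (le_trans _ (epsilon_trick _ _ _))//; last first.
  by move=> n; exact: lebesgue_outer_ge0.
pose P n (B : nat -> option (V * V)) := A n `<=` \bigcup_k box (B k) /\
  \sum_(k <oo) (box_volume (B k))%:E <=
    lebesgue_outer (A n) + (e%:num / (2 ^ n.+1)%:R)%:E.
have [G PG] : {G : nat -> nat -> option (V * V) & forall n, P n (G n)}.
  apply: (@choice _ _ P) => n; rewrite /P.
  have fA : lebesgue_outer (A n) \is a fin_num.
    rewrite ge0_fin_numE ?lebesgue_outer_ge0// ltey; exact/eqP/Aoo.
  have en1 : (0 < e%:num / (2 ^ n.+1)%:R :> R)%R by [].
  have [_ [B AB <-] lB] := lb_ereal_inf_adherent en1 fA.
  by exists B; split => //; exact/ltW.
pose vol (p : nat * nat) := (box_volume (G p.1 p.2))%:E.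
have vol_ge0 p : 0 <= vol p by exact: box_volume_ge0.
apply: (@le_trans _ _ (\esum_(p in setT) vol p)).
  apply: ereal_inf_lbound => /=.
  have /card_esym/ppcard_eqP[f] := card_nat2.
  exists (fun k => G (f k).1 (f k).2).
    move=> t [n _ /(PG n).1[k _ Gt]]; exists (f^-1%FUN (n, k)) => //=.
    by rewrite invK ?inE.
  rewrite -(esum_pred_image vol _ xpredT) ?[fun=> _]set_true//.
  by rewrite image_eq.
rewrite (_ : esum _ _ = \sum_(i <oo) \sum_(j <oo) vol (i, j)); last first.
  pose J : nat -> set (nat * nat) := fun i => [set (i, j) | j in setT].
  rewrite (_ : setT = \bigcup_k J k); last first.
    by rewrite predeqE => -[a b]; split => // _; exists a => //; exists b.
  rewrite esum_bigcupT /=; last 2 first.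
    - apply/trivIsetP => i j _ _ ij.
      rewrite predeqE => -[n m] /=; split => //= -[] [_] _ [<-{n} _].
      by move=> [m' _] [] /esym/eqP; rewrite (negbTE ij).
    - by move=> p; exact: vol_ge0.
  rewrite -(image_id [set: nat]) -fun_true esum_pred_image//; last first.
    by move=> n _; exact: esum_ge0.
  apply: eq_eseriesr => /= j _.
  rewrite -(esum_pred_image vol (pair j) predT)//=; last first.
    by move=> ? ? _ _; exact: (@can_inj _ _ _ snd).
  by congr esum; rewrite predeqE => -[a b]; split; move=> [i _ <-]; exists i.
apply: lee_nneseries => [n _ _|n _]; last exact: (PG n).2.
by apply: nneseries_ge0 => m _ _; exact: vol_ge0.
Qed.

HB.instance Definition _ := isOuterMeasure.Build R V lebesgue_outer
  lebesgue_outer0 lebesgue_outer_ge0 le_lebesgue_outer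
  lebesgue_outer_sigma_subadditive.

(* The measurable sets of this measure are the Lebesgue measurable sets; the
   carrier of [caratheodory_type _] is 'rV[R]_d itself. *)
Definition lebesgue_rV : set (caratheodory_type lebesgue_outer) -> \bar R :=
  lebesgue_outer.

HB.instance Definition _ := isMeasure.Build _ _ _ lebesgue_rV
  (@caratheodory_measure0 R V lebesgue_outer)
  (@caratheodory_measure_ge0 R V lebesgue_outer)
  (@caratheodory_measure_sigma_additive R V lebesgue_outer).

End lebesgue_rV.
Arguments lebesgue_outer R d A : clear implicits.
Arguments lebesgue_rV R d : clear implicits.

Section Ha_perimeter.
Context {R : realType} {d : nat}.
Local Notation V := 'rV[R]_d.
Implicit Types (x : V) (i : 'I_d) (u f : V -> R) (phi : V -> V).
Implicit Types (a : R) (Omega E : set V).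

(* The norm `|x| of the library on 'rV[R]_d is the sup norm. *)
Definition enorm x : R := Num.sqrt (\sum_(i < d) x 0 i ^+ 2).

Definition partial i u : V -> R := 'D_(delta_mx 0 i : V) u.

Definition Ha_sigma a : R :=
  (d%:R - 2) / 2 - Num.sqrt ((d%:R - 2) ^+ 2 + 4 * a) / 2.

Definition Ha_A_neg a i u x : R :=
  partial i u x - Ha_sigma a * (x 0 i / enorm x ^+ 2) * u x.

Definition Ha_div a phi x : R :=
  \sum_(i < d) Ha_A_neg a i (fun y => phi y 0 i) x.

Definition C1 u : Prop :=
  continuous u /\
  forall i, (forall x, derivable u x (delta_mx 0 i : V)) /\
            continuous (partial i u).

(* C_c^1(Omega, R^d): a compactly supported field on Omega is identified with
   its extension by 0 to the whole space. *)
Definition C1c Omega : set (V -> V) :=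
  [set phi : V -> V | [/\ forall i, C1 (fun x => phi x 0 i),
                          compact (closure [set x | phi x != 0]) &
                          closure [set x | phi x != 0] `<=` Omega]].

Definition test_field Omega : set (V -> V) :=
  [set phi : V -> V | C1c Omega phi /\
                      forall x, Omega x -> enorm (phi x) <= 1].

Local Open Scope ereal_scope.

Definition Ha_variation a Omega f : \bar R :=
  ereal_sup [set \int[lebesgue_rV R d]_(x in Omega) (f x * Ha_div a phi x)%:E
            | phi in test_field Omega].

Definition Ha_BV a Omega : set (V -> R) :=
  [set f : V -> R | (lebesgue_rV R d).-integrable Omega (EFin \o f) /\
           Ha_variation a Omega f < +oo].

Definition Ha_perimeter a E Omega : \bar R :=
  ereal_sup [set \int[lebesgue_rV R d]_(x in E) (Ha_div a phi x)%:E
            | phi in test_field Omega].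

End Ha_perimeter.

(* Main.v *)
Require Import Defs.
From HB Require Import structures.
From mathcomp Require Import all_boot all_order all_algebra.
From mathcomp Require Import all_classical all_reals all_analysis.
From mathcomp Require Import measurable_realfun.
From mathcomp Require Import lra.

Set Implicit Arguments.
Unset Strict Implicit.
Unset Printing Implicit Defensive.

Import Order.TTheory GRing.Theory Num.Theory.
Import numFieldNormedType.Exports.

Local Open Scope classical_set_scope.
Local Open Scope ring_scope.

(**
  Fix a test field phi, put g = div phi and G(t) = \int_{E_t} g; it must be
  shown that \int_Omega f g is at most the integral of P(E_t) over t.

  The layer-cake identity writes every real y as the integral over t of
  [t < y] - [t < 0].  Applied to y = f x, multiplied by g x and combined with
  Fubini's theorem, it gives
      \int_Omega f g = \int k(t) dt,   k(t) = G(t) - [t < 0] c,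
      c = \int_Omega g.
  If sigma = 0, then c = 0 by the divergence theorem, but the term
  - sigma x / |x|^2 makes c nonzero in general.  Its sign decides:
  - if c >= 0, then k <= G <= P(E_t), and integrating in t concludes;
  - if c < 0, then P(E_t) >= - G(t) (use the test field - phi), that is
    P(E_t) >= - c - k(t) for t < 0, where - c > 0 is constant and k is
    integrable, so that the right-hand side is +oo.
  Both cases only use |G(t)| <= P(E_t), which holds because test fields are
  stable under opposite.  This is integral_mul_le_of_superlevel, stated for an
  arbitrary sigma-finite measure, with g and f g integrable.

  What remains is that g is an admissible weight.  It is continuous away from
  the origin and vanishes off the compact support of phi, which lies in Omega
  and hence avoids the origin; so g is bounded, and it is integrable as soon as
  open sets are measurable and bounded sets have finite measure
  (open_lebesgue_rV_measurable, compact_lebesgue_rV_lty).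
*)

(** * Integrals bounded by the integral of an arbitrary function *)

Section monotone.
Local Open Scope ereal_scope.
Context d (T : measurableType d) (R : realType).
Variable mu : {measure set T -> \bar R}.

(** The perimeter of E_t is a supremum over an uncountable family, so it is not
  known to be measurable in t.  Monotonicity survives: the integral of any
  nonnegative function is the supremum of the integrals of the simple functions
  below it. *)
Lemma ge0_le_integral_nonmeasurable (D : set T) (f g : T -> \bar R) :
  (forall x, D x -> 0 <= f x) -> (forall x, D x -> f x <= g x) ->
  \int[mu]_(x in D) f x <= \int[mu]_(x in D) g x.
Proof.
move=> f0 fg; have g0 x : D x -> 0 <= g x.
  by move=> Dx; rewrite (le_trans (f0 x Dx))// fg.
rewrite !ge0_integralE//; apply: ereal_sup_le => _ [h /= hf <-]; exists h => //.
move=> x; apply: le_trans (hf x) _; exact: lee_restrict.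
Qed.

Lemma integrable_le_integral_nonmeasurable (D : set T) (f g : T -> \bar R) :
  measurable D -> mu.-integrable D f ->
  (forall x, D x -> 0 <= g x) -> (forall x, D x -> f x <= g x) ->
  \int[mu]_(x in D) f x <= \int[mu]_(x in D) g x.
Proof.
move=> mD fi g0 fg; apply: (@le_trans _ _ (\int[mu]_(x in D) f^\+ x)).
  apply: le_integral => //; first exact: integrable_funepos.
  by move=> x _; rewrite funeposE le_max lexx.
apply: ge0_le_integral_nonmeasurable => // x Dx.
by rewrite funeposE ge_max fg// g0.
Qed.
End monotone.

(** * The layer-cake identity *)

Section layer.
Context {R : realType}.
Implicit Types y t : R.

(** Subtracting [t < 0] makes the layers of y integrable over the whole line,
  whatever the sign of y. *)
Definition layer y t : R := (t < y)%R%:R - (t < 0)%R%:R.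

Lemma layerE y t :
  layer y t = \1_(`[0%R, y[%classic) t - \1_(`[y, 0%R[%classic) t.
Proof.
rewrite /layer !indicE !mem_setE !in_itv/=.
by case: (ltP t y); case: (ltP t 0); rewrite /= ?subr0 ?sub0r ?subrr.
Qed.

Lemma norm_layerE y t :
  `|layer y t| = \1_(`[0%R, y[%classic) t + \1_(`[y, 0%R[%classic) t.
Proof.
rewrite /layer !indicE !mem_setE !in_itv/=.
by case: (ltP t y); case: (ltP t 0) => /=;
  rewrite ?subr0 ?sub0r ?subrr ?normr0 ?normrN ?normr1 ?addr0 ?add0r.
Qed.

Let mu_pos y : lebesgue_measure `[0, y[%classic = (Num.max 0 y)%:E.
Proof.
rewrite lebesgue_measure_itv/= lte_fin.
by case: ltP => // _; rewrite oppr0 addr0.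
Qed.

Let mu_neg y : lebesgue_measure `[y, 0[%classic = (Num.max 0 (- y))%:E.
Proof.
rewrite lebesgue_measure_itv/= lte_fin; case: ltP => y0.
  rewrite max_r; last by rewrite oppr_ge0 ltW.
  by rewrite add0e.
by rewrite max_l// oppr_le0.
Qed.

Lemma integral_layer y : (\int[lebesgue_measure]_t (layer y t)%:E = y%:E)%E.
Proof.
under eq_integral do rewrite layerE EFinB.
rewrite integralB//; [|exact: integrable_indic_itv|exact: integrable_indic_itv].
rewrite !integral_indic// !setIT.
transitivity ((Num.max 0 y)%:E - (Num.max 0 (- y))%:E)%E.
  by congr (_ - _)%E; [exact: mu_pos|exact: mu_neg].
rewrite -EFinB; congr EFin; case: (lerP 0 y) => y0.
  by rewrite max_l ?subr0// oppr_le0.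
by rewrite max_r ?sub0r ?opprK// oppr_ge0 ltW.
Qed.

Lemma integral_norm_layer y :
  (\int[lebesgue_measure]_t (`|layer y t|)%:E = `|y|%:E)%E.
Proof.
under eq_integral do rewrite norm_layerE EFinD.
rewrite integralD//; [|exact: integrable_indic_itv|exact: integrable_indic_itv].
rewrite !integral_indic// !setIT.
transitivity ((Num.max 0 y)%:E + (Num.max 0 (- y))%:E)%E.
  by congr (_ + _)%E; [exact: mu_pos|exact: mu_neg].
rewrite -EFinD; congr EFin; case: (lerP 0 y) => y0.
  by rewrite max_l ?addr0 ?ger0_norm// oppr_le0.
by rewrite max_r ?add0r ?ltr0_norm// oppr_ge0 ltW.
Qed.

End layer.

Lemma measurable_fun_layer {R : realType} d (T : measurableType d)
    (f h : T -> R) :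
  measurable_fun setT f -> measurable_fun setT h ->
  measurable_fun setT (fun z => layer (f z) (h z)).
Proof.
move=> mf mh; rewrite /layer.
have mb (b : T -> bool) : measurable_fun setT b ->
    measurable_fun setT (fun z => (b z)%:R : R).
  by move=> mb; exact: (measurableT_comp (f := fun b : bool => b%:R : R)).
by apply: measurable_funB; apply: mb; exact: measurable_fun_ltr.
Qed.

Section superlevel.
Local Open Scope ereal_scope.
Context d (T : measurableType d) (R : realType).
Variable mu : {sigma_finite_measure set T -> \bar R}.
Local Notation leb := (@lebesgue_measure R).

Let layered (f g : T -> R) (z : T * measurableTypeR R) : \bar R :=
  (layer (f z.1) z.2 * g z.1)%:E.

Let layered_measurable (f g : T -> R) :
  measurable_fun setT f -> measurable_fun setT g ->
  measurable_fun setT (layered f g).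
Proof.
move=> mf mg; apply/measurable_EFinP; apply: measurable_funM; last first.
  exact: (measurableT_comp mg).
apply: measurable_fun_layer => //; exact: (measurableT_comp mf).
Qed.

(** Tonelli: integrating the absolute value in t first gives |f g|. *)
Let layered_integrable (f g : T -> R) :
  measurable_fun setT f -> measurable_fun setT g ->
  mu.-integrable setT (EFin \o (f \* g)%R) ->
  (mu \x leb).-integrable setT (layered f g).
Proof.
move=> mf mg /integrableP[mfg fgoo]; apply/integrable12ltyP.
  exact: layered_measurable.
apply: le_lt_trans fgoo; rewrite le_eqVlt; apply/orP; left; apply/eqP.
apply: eq_integral => x _ /=.
under eq_integral do rewrite /layered/= normrM EFinM.
rewrite ge0_integralZr//.
- by rewrite integral_norm_layer normrM EFinM.
- apply/measurable_EFinP; apply: measurableT_comp => //.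
  exact: measurable_fun_layer.
Qed.

Let integral_mul_layer (f g : T -> R) :
  measurable_fun setT f -> measurable_fun setT g ->
  mu.-integrable setT (EFin \o (f \* g)%R) ->
  \int[mu]_x (f x * g x)%:E = \int[leb]_t \int[mu]_x (layer (f x) t * g x)%:E.
Proof.
move=> mf mg ifg; have iF := layered_integrable mf mg ifg.
rewrite -[RHS](Fubini iF); apply: eq_integral => x _.
under [RHS]eq_integral do rewrite /layered/= EFinM.
rewrite integralZr//.
  by rewrite integral_layer EFinM.
apply/integrableP; split; last by rewrite integral_norm_layer ltry.
apply/measurable_EFinP.
exact: measurable_fun_layer.
Qed.

(** A coarea inequality for a weight g of arbitrary total mass c on D.  By the
  layer-cake identity \int_D f g = \int k with k(t) = G(t) - [t < 0] c and G(t)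
  the mass of g on the superlevel set.  If c >= 0 then k <= G <= P; if c < 0
  then P >= - G forces \int P = +oo, because - G is the integrable function - k
  plus the positive constant - c on the half-line t < 0.  The absolute value in
  the hypothesis serves both cases. *)
Lemma integral_mul_le_of_superlevel (D : set T) (f g : T -> R)
    (P : R -> \bar R) :
  measurable D -> measurable_fun D f ->
  mu.-integrable D (EFin \o g) ->
  mu.-integrable D (EFin \o (f \* g)%R) ->
  (forall t,
    `|\int[mu]_(x in [set x | D x /\ (t < f x)%R]) (g x)%:E| <= P t) ->
  \int[mu]_(x in D) (f x * g x)%:E <= \int[leb]_t P t.
Proof.
move=> mD mf ig ifg gP.
have P0 t : 0 <= P t by exact: le_trans (abse_ge0 _) (gP t).
have mg : measurable_fun D g.
  by apply/measurable_EFinP; exact: measurable_int ig.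
pose f0 := f \_ D; pose g0 := g \_ D.
have mf0 : measurable_fun setT f0 by exact/(measurable_restrictT _ _).1.
have mg0 : measurable_fun setT g0 by exact/(measurable_restrictT _ _).1.
have ig0 : mu.-integrable setT (EFin \o g0).
  by rewrite /g0 -restrict_EFin; exact/(integrable_mkcond _ mD).1.
have fg0E : (f0 \* g0)%R = (f \* g)%R \_ D.
  by apply/funext => x; rewrite /f0 /g0/= !patchE; case: ifPn; rewrite ?mul0r.
have ifg0 : mu.-integrable setT (EFin \o (f0 \* g0)%R).
  by rewrite fg0E -restrict_EFin; exact/(integrable_mkcond _ mD).1.
pose k t := \int[mu]_x (layer (f0 x) t * g0 x)%:E.
pose c := \int[mu]_x (g0 x)%:E.
have cfin : c \is a fin_num by exact: integrable_fin_num ig0.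
have ib (b : T -> bool) : measurable_fun setT b ->
    mu.-integrable setT (fun x => ((b x)%:R * g0 x)%:E).
  move=> mb; apply: (le_integrable measurableT _ _ ig0).
    apply/measurable_EFinP; apply: measurable_funM => //.
    exact: (measurableT_comp (f := fun b : bool => b%:R : R)).
  move=> x _ /=; rewrite lee_fin normrM; case: (b x); rewrite ?normr1 ?mul1r//.
  by rewrite normr0 mul0r.
have ih t : mu.-integrable setT (fun x => (layer (f0 x) t * g0 x)%:E).
  under eq_fun do rewrite /layer mulrBl EFinB.
  by apply: integrableB => //; apply: ib => //; exact: measurable_fun_ltr.
have kfin t : k t \is a fin_num by exact: integrable_fin_num (ih t).
have ik : leb.-integrable setT k.
  have iF := layered_integrable mf0 mg0 ifg0.
  apply/integrableP; split; first exact: measurable_fubini_G iF.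
  have : \int[leb]_t \int[mu]_x `|layered f0 g0 (x, t)| < +oo.
    by apply/integrable21ltyP => //; exact: measurable_int iF.
  apply: le_lt_trans.
  apply: ge0_le_integral_nonmeasurable => // t _.
  by apply: le_abse_integral => //; exact: measurable_int (ih t).
have kE t : \int[mu]_(x in [set x | D x /\ (t < f x)%R]) (g x)%:E =
    k t + (t < 0)%R%:R%:E * c.
  rewrite integral_mkcond.
  transitivity (\int[mu]_x ((t < f0 x)%R%:R * g0 x)%:E).
    apply: eq_integral => x _; rewrite /f0 /g0 !patchE.
    have [Dx|Dx] := boolP (x \in D); last first.
      by rewrite mulr0 memNset// => -[Dx' _]; rewrite mem_set in Dx.
    case: ltP => tf.
      by rewrite mem_set ?mul1r//; split => //; exact: set_mem.
    by rewrite memNset ?mul0r// => -[_]; rewrite ltNge tf.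
  rewrite /k.
  under [X in _ = X + _]eq_integral do rewrite /layer mulrBl EFinB.
  rewrite integralB//; [|exact/ib/measurable_fun_ltr|exact/ib].
  under [X in _ = _ - X + _]eq_integral do rewrite EFinM.
  rewrite integralZl// subeK//.
  by rewrite fin_numM.
have -> : \int[mu]_(x in D) (f x * g x)%:E = \int[leb]_t k t.
  rewrite /k -integral_mul_layer// integral_mkcond; apply: eq_integral => x _.
  by rewrite /f0 /g0 !patchE; case: ifPn; rewrite ?mul0r.
have [c0|c0] := leP 0 c.
  apply: integrable_le_integral_nonmeasurable => // t _.
  apply: le_trans (gP t); apply: le_trans (lee_abs _).
  by rewrite kE leeDl// mule_ge0// lee_fin ler0n.
(* Now c < 0: P is bounded below by the measurable q, the positive part of
   r [t < 0] - |k t| with r = - c, and the integral of q is infinite since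
   r [t < 0] <= q + |k|. *)
suff -> : \int[leb]_t P t = +oo by rewrite leey.
pose K : R -> \bar R := abse \o k.
have mK : measurable_fun setT K.
  by apply: measurableT_comp => //; exact: measurable_int ik.
have iK : \int[leb]_t K t < +oo by case/integrableP: ik.
pose r := (- fine c)%R.
have r0 : (0 < r)%R by rewrite oppr_gt0 -lte_fin fineK.
pose s (t : R) : \bar R := r%:E * (\1_(`]-oo, 0%R[%classic) t : R)%:E.
pose q : R -> \bar R := funepos (fun t => s t - K t).
have ms : measurable_fun setT s.
  by apply: measurable_funeM; exact/measurable_EFinP/measurable_indic.
have mq : measurable_fun setT q.
  by apply: measurable_funepos; exact: emeasurable_funB.
have s0 t : 0 <= s t by rewrite mule_ge0// lee_fin// ltW.
have qP t : q t <= P t.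
  rewrite /q funeposE ge_max P0 andbT; apply: le_trans (gP t).
  rewrite kE /s /K/= indicE mem_setE in_itv/= -(fineK (kfin t)) -(fineK cfin).
  rewrite lee_fin /r.
  have := ler_norm (- (fine (k t) + (t < 0)%R%:R * fine c)).
  have := ler_norm (fine (k t)); rewrite normrN.
  by case: (t < 0)%R; rewrite ?mulr1 ?mul1r ?mulr0 ?mul0r; lra.
have : +oo <= \int[leb]_t (q t + K t).
  have <- : \int[leb]_t s t = +oo.
    rewrite ge0_integralZl//; last 2 first.
    - exact/measurable_EFinP/measurable_indic.
    - by rewrite lee_fin ltW.
    have -> : \int[leb]_t (\1_(`]-oo, 0%R[%classic) t)%:E = +oo.
      rewrite integral_indic// setIT.
      by have := @lebesgue_measure_itv R `]-oo, 0%R[; rewrite /= ltNyr.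
    by rewrite gt0_muley.
  apply: ge0_le_integral => //.
    exact: emeasurable_funD.
  move=> t _; rewrite -leeBlDr.
    by rewrite /q funeposE le_max lexx.
  by rewrite /K/= abse_fin_num.
have q0 t : 0 <= q t by rewrite /q funeposE le_max lexx orbT.
have K0 t : 0 <= K t by rewrite /K/= abse_ge0.
rewrite (@ge0_integralD _ _ _ leb)//.
rewrite leNgt => /negP qKoo.
apply/eqP; rewrite -leye_eq leNgt; apply/negP => Poo; apply: qKoo.
rewrite lte_add_pinfty//; apply: le_lt_trans Poo.
by apply: ge0_le_integral_nonmeasurable.
Qed.

End superlevel.

(** * Lebesgue measurability of the open sets of R^d *)

Section lebesgue_rV_open.
Context {R : realType} {d : nat}.
Local Notation V := 'rV[R]_d.
Local Notation mu := (lebesgue_rV R d).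
Local Notation Lmeasurable A :=
  (@measurable _ (caratheodory_type (lebesgue_outer R d)) A).

Definition cut_below (i : 'I_d) (t : R) (c : option (V * V)) :
    option (V * V) :=
  omap (fun ab : V * V =>
    (ab.1, \row_j (if j == i then Num.min (ab.2 0 j) t else ab.2 0 j) : V)) c.

Definition cut_above (i : 'I_d) (t : R) (c : option (V * V)) :
    option (V * V) :=
  omap (fun ab : V * V =>
    (\row_j (if j == i then Num.max (ab.1 0 j) t else ab.1 0 j) : V, ab.2)) c.

Lemma box_cut_below i t c :
  box c `&` [set x : V | x 0 i <= t] `<=` box (cut_below i t c).
Proof.
case: c => [[a b]|] x [//= Bx xt] j; rewrite mxE.
by case: eqP => [->|_]; rewrite ?le_min ?xt ?andbT Bx.
Qed.

Lemma box_cut_above i t c :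
  box c `&` ~` [set x : V | x 0 i <= t] `<=` box (cut_above i t c).
Proof.
case: c => [[a b]|] x [//= Bx /negP]; rewrite -ltNge => xt j; rewrite mxE.
by case: eqP => [->|_]; rewrite ?gt_max ?xt ?andbT Bx.
Qed.

(** Only the i-th factor of the volume changes; both sides agree even when t
  lies outside the i-th side, or when that side is empty, because lengths are
  truncated at 0. *)
Lemma box_volume_cut i t c :
  box_volume (cut_below i t c) + box_volume (cut_above i t c) =
  box_volume c :> R.
Proof.
case: c => [[a b]|] /=; last by rewrite addr0.
rewrite (bigD1 i)//= [X in _ + X](bigD1 i)//= [RHS](bigD1 i)//= !mxE eqxx.
under eq_bigr => j ji do rewrite mxE (negbTE ji).
under [X in _ + _ * X = _]eq_bigr => j ji do rewrite mxE (negbTE ji).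
rewrite -mulrDl; congr (_ * _).
have [] := leP (b 0 i) t; have [] := leP (a 0 i) t => at' bt;
  rewrite /Num.max; repeat case: ltP => ?; lra.
Qed.

(** Cutting every box of a cover of X along the hyperplane yields covers of the
  two parts of X without changing the total volume: this is Caratheodory's
  criterion. *)
Lemma measurable_halfspace (i : 'I_d) (t : R) :
  Lmeasurable [set x : V | x 0 i <= t].
Proof.
apply: le_caratheodory_measurable => X; apply: le_ereal_inf_tmp => _ [c Xc <-].
set H := [set x | _].
apply: (@le_trans _ _ (\sum_(k <oo) (box_volume (cut_below i t (c k)))%:E +
                       \sum_(k <oo) (box_volume (cut_above i t (c k)))%:E)%E).
  apply: leeD; apply: ereal_inf_lbound.
  - exists (fun k => cut_below i t (c k)) => // x [/Xc [k _ ckx] Hx].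
    by exists k => //; exact: box_cut_below.
  - exists (fun k => cut_above i t (c k)) => // x [/Xc [k _ ckx] Hx].
    by exists k => //; exact: box_cut_above.
rewrite -nneseriesD; last 2 first.
- by move=> k _ _; exact: box_volume_ge0.
- by move=> k _ _; exact: box_volume_ge0.
by under eq_eseriesr do rewrite -EFinD box_volume_cut.
Qed.

Lemma measurable_box (c : option (V * V)) : Lmeasurable (box c).
Proof.
case: c => [[a b]|] /=; last exact: measurable0.
rewrite (_ : [set x | _] = \bigcap_(i in [set: 'I_d])
  ([set x : V | x 0 i <= b 0 i] `\` [set x : V | x 0 i <= a 0 i])); last first.
  apply/seteqP; split=> [x abx i _|x abx i].
    by have /andP[ax xb] := abx i; split=> //; apply/negP; rewrite -ltNge.
  by have [xb /negP] := abx i Logic.I; rewrite -ltNge => ->.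
apply: fin_bigcap_measurable => // i _.
by apply: measurableD; exact: measurable_halfspace.
Qed.

(** An open set is the countable union of the boxes with rational corners that
  it contains. *)
Lemma open_lebesgue_rV_measurable (U : set V) : open U -> Lmeasurable U.
Proof.
move=> oU; pose q2 (p : 'rV[rat]_d * 'rV[rat]_d) : option (V * V) :=
  Some (map_mx ratr p.1, map_mx ratr p.2).
pose B p := if pselect (box (q2 p) `<=` U) then box (q2 p) else set0.
rewrite (_ : U = \bigcup_p B p).
  apply: countable_bigcupT_measurable => [|p].
    exact: countableP.
  by rewrite /B; case: pselect => ?; [exact: measurable_box|exact: measurable0].
apply/seteqP; split=> x; last first.
  by case=> p _; rewrite /B; case: pselect => // BU /BU.
move=> Ux.
have : nbhs x U by exact: open_nbhs_nbhs.
move=> /nbhs_ballP[e /= e0 xeU].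
have [p Hp] : exists p : 'rV[rat]_d, forall i, x 0 i - e < ratr (p 0 i) < x 0 i.
  have H i : exists r : rat, x 0 i - e < ratr r < x 0 i.
    have [|r] := @rat_in_itvoo R (x 0 i - e) (x 0 i); first by rewrite gtrBl.
    by rewrite inE; exists r.
  by have [f Hf] := choice H; exists (\row_i f i) => i; rewrite mxE.
have [q Hq] : exists p : 'rV[rat]_d, forall i, x 0 i < ratr (p 0 i) < x 0 i + e.
  have H i : exists r : rat, x 0 i < ratr r < x 0 i + e.
    have [|r] := @rat_in_itvoo R (x 0 i) (x 0 i + e); first by rewrite ltrDl.
    by rewrite inE; exists r.
  by have [f Hf] := choice H; exists (\row_i f i) => i; rewrite mxE.
exists (p, q) => //; rewrite /B; case: pselect => [?|].
  move=> i /=; rewrite !mxE.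
  by have /andP[_ ->] := Hp i; have /andP[/ltW -> _] := Hq i.
case; move=> y /= By; apply: xeU; split=> // i j; rewrite ord1 /ball/=.
have := By j; rewrite !mxE => /andP[py yq].
have /andP[p1 p2] := Hp j; have /andP[q1 q2'] := Hq j.
rewrite ltr_norml; lra.
Qed.

Lemma closed_lebesgue_rV_measurable (U : set V) : closed U -> Lmeasurable U.
Proof.
move=> cU; rewrite -(setCK U).
exact/measurableC/open_lebesgue_rV_measurable/closed_openC.
Qed.

Lemma lebesgue_rV_box_lty (c : option (V * V)) : (mu (box c) < +oo)%E.
Proof.
apply: (@le_lt_trans _ _ (box_volume c)%:E); last by rewrite ltry.
apply: ereal_inf_lbound; exists (fun k => if k == 0%N then c else None).
  by move=> x cx; exists 0%N.
rewrite nneseries_recl//; last by move=> k _; exact: box_volume_ge0.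
by rewrite eseries0 ?adde0// => -[].
Qed.

Lemma coord_le_norm (x : V) (i : 'I_d) : `|x 0 i| <= `|x|.
Proof.
rewrite [leRHS]/Num.norm/= mx_normrE.
by apply/bigmax_geP; right; exists (0, i).
Qed.

Definition cube (n : nat) : option (V * V) :=
  Some (const_mx (- n%:R), const_mx n%:R).

Lemma norm_lt_cube (n : nat) (x : V) : `|x| < n%:R -> box (cube n) x.
Proof.
move=> xn i; rewrite !mxE.
have : `|x 0 i| < n%:R by exact: le_lt_trans (coord_le_norm x i) xn.
by rewrite ltr_norml => /andP[-> /ltW].
Qed.

Lemma lebesgue_rV_sigma_finite : sigma_finite setT mu.
Proof.
exists (fun n => box (cube n)).
  apply/seteqP; split => // x _.
  by exists (Num.truncn `|x|).+1 => //; apply: norm_lt_cube; exact: truncnS_gt.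
by move=> n; split; [exact: measurable_box|exact: lebesgue_rV_box_lty].
Qed.

HB.instance Definition _ := Measure_isSigmaFinite.Build _ _ _ (lebesgue_rV R d)
  lebesgue_rV_sigma_finite.

Lemma compact_lebesgue_rV_lty (K : set V) : compact K -> (mu K < +oo)%E.
Proof.
move=> cK; have [M [Mr KM]] := compact_bounded cK.
pose n := (Num.truncn (M + 1)).+1.
apply: le_lt_trans (lebesgue_rV_box_lty (cube n)).
apply: le_lebesgue_outer => x Kx; apply: norm_lt_cube.
apply: le_lt_trans (truncnS_gt (M + 1)); apply: KM => //.
by rewrite ltrDl.
Qed.

Lemma continuous_lebesgue_rV_measurable (U : set V) (g : V -> R) : open U ->
  {in U, continuous g} ->
  measurable_fun (U : set (caratheodory_type (lebesgue_outer R d))) g.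
Proof.
move=> oU cg mU; apply: (measurability _ (RGenOpens.measurableE R)) => //.
move=> _ [_ [a [b ->]] <-].
apply: open_lebesgue_rV_measurable; rewrite openE => x [Ux gx].
apply: filterI; first exact: open_nbhs_nbhs.
by apply: (cg x (mem_set Ux)); exact: open_nbhs_nbhs.
Qed.
End lebesgue_rV_open.

(** * Regularity of the divergence of a test field *)

Section Ha_div_regularity.
Context {R : realType} {d : nat}.
Local Notation V := 'rV[R]_d.
Variables (a : R) (Omega : set V).
Hypothesis Omega0 : Omega `<=` [set~ 0].
Variable phi : V -> V.
Hypothesis C1phi : C1c Omega phi.
Local Notation K := (closure [set x | phi x != 0]).

Lemma enorm_sqr (x : V) : enorm x ^+ 2 = \sum_(i < d) x 0 i ^+ 2.
Proof. by rewrite sqr_sqrtr// sumr_ge0// => i _; rewrite sqr_ge0. Qed.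

Lemma enorm_sqr_eq0 (x : V) : (enorm x ^+ 2 == 0) = (x == 0).
Proof.
rewrite enorm_sqr psumr_eq0; last by move=> i _; rewrite sqr_ge0.
apply/allP/eqP => [x0|-> i _]; last by rewrite /= mxE expr0n.
apply/rowP => i; rewrite mxE; apply/eqP.
by have := x0 i (mem_index_enum i); rewrite sqrf_eq0.
Qed.

Lemma continuous_sum_at (T : topologicalType) (F : 'I_d -> T -> R) (x : T) :
  (forall i, {for x, continuous (F i)}) ->
  {for x, continuous (fun y => \sum_(i < d) F i y)}.
Proof.
by move=> cF; apply: cvg_big => [|i _]; [exact: add_continuous|exact: cF].
Qed.

Lemma continuous_enorm_sqr : continuous (fun x : V => enorm x ^+ 2).
Proof.
move=> x; rewrite (funext enorm_sqr); apply: continuous_sum_at => i.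
by apply: (@cvg_comp _ _ _ (fun y : V => y 0 i) (fun r : R => r ^+ 2));
  [exact: coord_continuous|exact: exprn_continuous].
Qed.

Lemma Ha_div_continuous (x : V) : x != 0 -> {for x, continuous (Ha_div a phi)}.
Proof.
move=> x0; apply: continuous_sum_at => i; rewrite /Ha_A_neg.
have [C1 _ _] := C1phi; have [cphi dphi] := C1 i.
apply: continuousB; first exact: (dphi i).2.
apply: continuousM; last exact: cphi.
apply: continuousM; first exact: cst_continuous.
apply: continuousM; first exact: coord_continuous.
apply: continuousV; first by rewrite enorm_sqr_eq0.
exact: continuous_enorm_sqr.
Qed.

Lemma Ha_div_eq0 (x : V) : ~ K x -> Ha_div a phi x = 0.
Proof.
move=> Kx; have phi0 : \forall y \near x, phi y = 0.
  have : open_nbhs x (~` K) by split => //; exact/closed_openC/closed_closure.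
  move/open_nbhs_nbhs; apply: filterS => y Ky; apply/eqP/negP => /negP phiy.
  by apply: Ky; exact: subset_closure.
rewrite /Ha_div big1// => i _.
rewrite /Ha_A_neg (nbhs_singleton phi0) mxE mulr0 subr0.
rewrite /partial (@near_eq_derive _ _ _ _ (cst 0)) ?derive_cst//.
by apply: filterS phi0 => y ->; rewrite mxE.
Qed.

(** The support of phi is a compact subset of Omega, so it avoids the only
  singularity of the weight x / |x|^2; off the support the divergence is 0. *)
Lemma Ha_div_bounded (A : set V) : [bounded Ha_div a phi x | x in A].
Proof.
have [_ cK KO] := C1phi.
have cg : {within K, continuous (Ha_div a phi)}.
  apply/subspace_continuousP => x Kx; apply: cvg_within_filter.
  by apply: Ha_div_continuous; apply/eqP/Omega0/KO.
have [M [Mr HM]] := compact_bounded (continuous_compact cg cK).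
exists (Num.max M 0); split; first by rewrite max_real.
move=> m; rewrite gt_max => /andP[Mm m0] x _ /=.
have [Kx|Kx] := pselect (K x); first by apply: (HM m Mm); exists x.
by rewrite Ha_div_eq0// normr0 ltW.
Qed.

Lemma Ha_div_measurable : open Omega ->
  measurable_fun (Omega : set (caratheodory_type (lebesgue_outer R d)))
    (Ha_div a phi).
Proof.
move=> oO; apply: continuous_lebesgue_rV_measurable => // x; rewrite inE => Ox.
by apply: Ha_div_continuous; exact/eqP/Omega0.
Qed.

Lemma Ha_div_integrable : open Omega ->
  (lebesgue_rV R d).-integrable Omega (EFin \o Ha_div a phi).
Proof.
move=> oO; have [_ cK KO] := C1phi.
have mO := open_lebesgue_rV_measurable oO.
have mK :=
  closed_lebesgue_rV_measurable (@closed_closure _ [set x | phi x != 0]).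
have : (lebesgue_rV R d).-integrable K (EFin \o Ha_div a phi).
  apply: measurable_bounded_integrable => //.
  - exact: compact_lebesgue_rV_lty.
  - exact: measurable_funS (Ha_div_measurable oO).
  - exact: Ha_div_bounded.
move/(integrable_mkcond _ mK).1.
rewrite (_ : _ \_ _ = EFin \o Ha_div a phi); last first.
  apply/funext => x; rewrite patchE; case: ifPn => //.
  by move/negP; rewrite inE => /Ha_div_eq0 /= ->.
by apply: integrableS.
Qed.
End Ha_div_regularity.

(** * Symmetry of the perimeter under opposite test fields *)

Section opp.
Context {R : realType} {d : nat}.
Local Notation V := 'rV[R]_d.
Variables (a : R) (Omega : set V).

Lemma C1N (u : V -> R) : C1 u -> C1 (fun x => - u x).
Proof.
move=> [cu du]; split; first by move=> x; apply: continuousN; exact: cu.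
move=> i; have [dui cui] := du i; split; first by move=> x; exact: derivableN.
have -> : partial i (fun x => - u x) = - partial i u.
  by apply/funext => x; rewrite /partial; exact: deriveN.
by move=> x; apply: continuousN; exact: cui.
Qed.

Lemma C1cN (phi : V -> V) : C1c Omega phi -> C1c Omega (- phi).
Proof.
move=> [C1phi cK KO].
have suppN : [set x | (- phi) x != 0] = [set x | phi x != 0].
  by apply/funext => x /=; rewrite opprfctE oppr_eq0.
split; rewrite ?suppN// => i.
rewrite (_ : (fun x => _) = (fun x => - phi x 0 i)); first exact: C1N.
by apply/funext => x; rewrite opprfctE mxE.
Qed.

Lemma enormN (x : V) : enorm (- x) = enorm x.
Proof. by congr Num.sqrt; apply: eq_bigr => i _; rewrite mxE sqrrN. Qed.

Lemma test_fieldN (phi : V -> V) :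
  test_field Omega phi -> test_field Omega (- phi).
Proof.
move=> [/C1cN cphi phi1]; split => // x Ox.
by rewrite opprfctE enormN phi1.
Qed.

Lemma Ha_divN (phi : V -> V) (x : V) : C1c Omega phi ->
  Ha_div a (- phi) x = - Ha_div a phi x.
Proof.
move=> [C1phi _ _]; rewrite /Ha_div -sumrN; apply: eq_bigr => i _.
rewrite /Ha_A_neg /partial.
rewrite (_ : (fun y => _) = - (fun y => phi y 0 i)); last first.
  by apply/funext => y; rewrite !opprfctE mxE.
rewrite deriveN; last exact: ((C1phi i).2 i).1.
by rewrite opprfctE mxE mulrN opprB opprK addrC.
Qed.

Lemma abse_integral_Ha_div_le_perimeter (E : set V) (phi : V -> V) :
  measurable (E : set (caratheodory_type (lebesgue_outer R d))) ->
  (lebesgue_rV R d).-integrable E (EFin \o Ha_div a phi) ->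
  test_field Omega phi ->
  (`|\int[lebesgue_rV R d]_(x in E) (Ha_div a phi x)%:E| <=
   Ha_perimeter a E Omega)%E.
Proof.
move=> mE ig tphi; set I := integral _ _ _.
have [I0|I0] := leP 0%E I.
  by rewrite gee0_abs//; apply: ereal_sup_ubound; exists phi.
rewrite lte0_abs//; apply: ereal_sup_ubound.
exists (- phi); first exact: test_fieldN.
under eq_integral do rewrite (Ha_divN _ tphi.1) EFinN.
by rewrite integralN//; exact: integrable_add_def.
Qed.
End opp.

(** * The coarea inequality *)

Theorem theorem2p10 (R : realType) (d : nat) (a : R) (Omega : set 'rV[R]_d)
    (f : 'rV[R]_d -> R) :
  (2 <= d)%N ->
  - (d%:R / 2 - 1) ^+ 2 <= a ->
  open Omega -> connected Omega -> Omega !=set0 ->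
  Omega `<=` [set~ 0] ->
  Ha_BV a Omega f ->
  (Ha_variation a Omega f <=
   \int[lebesgue_measure]_(t in [set: R])
     Ha_perimeter a [set x | Omega x /\ (t < f x)%R] Omega)%E.
Proof.
move=> _ _ oO _ _ O0 [fi _]; apply: ge_ereal_sup => _ [phi tphi <-].
have mO := open_lebesgue_rV_measurable oO.
have mf :
    measurable_fun (Omega : set (caratheodory_type (lebesgue_outer R d))) f.
  by apply/measurable_EFinP; exact: measurable_int fi.
have gi := Ha_div_integrable a O0 tphi.1 oO.
apply: (@integral_mul_le_of_superlevel _ _ _ (lebesgue_rV R d) Omega f
  (Ha_div a phi)
  (fun t => Ha_perimeter a [set x | Omega x /\ t < f x] Omega)) => //.
- have mg := Ha_div_measurable a O0 tphi.1 oO.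
  exact: (integrableMl mO fi mg (Ha_div_bounded a O0 tphi.1 Omega)).
- move=> t.
  have mEt : measurable ([set x | Omega x /\ t < f x] :
      set (caratheodory_type (lebesgue_outer R d))).
    have := mf mO `]t, +oo[%classic (measurable_itv _).
    by congr (measurable _); apply/seteqP; split => x [Ox];
      rewrite /= in_itv/= andbT.
  apply: abse_integral_Ha_div_le_perimeter => //.
  by apply: integrableS gi => // x [].
Qed.
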